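(* Let $n\ge 1$ and let $M_n$ be the monoid given by the monoid presentation with generators $e_{i,j}$ ($1\le i<j\le n$) and defining relations (all indices in $\{1,\dots,n\}$, and each generator occurring has first index smaller than its second index): \begin{align*} e_{i,j}^2&=e_{i,j} && (i<j),\\ e_{i,j}e_{k,l}&=e_{k,l}e_{i,j} && (i<j,\ k<l,\ \{i,j\}\cap\{k,l\}=\varnothing),\\ e_{i,j}e_{i,k}&=e_{j,k}e_{i,j} && (i<j<k),\\ e_{i,k}e_{i,j}&=e_{j,k}e_{i,j} && (i<j<k),\\ e_{i,k}e_{j,k}&=e_{i,k} && (i,j<k). \end{align*} Then $M_n$ is isomorphic to $D_n$.
   Context: $[n]=\{1,\dots,n\}$ with its natural linear order. Maps act on the right and are composed from left to right: $x(\alpha\beta)=(x\alpha)\beta$. A map $\alpha$ is order-decreasing if $x\alpha\le x$ for all $x$ in its domain. $D_n$ is the monoid (under composition) of all full (everywhere-defined) order-decreasing maps $[n]\to[n]$. For a set $A$ and $R\subseteq A^*\times A^*$, the monoid presentation $\langle A:R\rangle$ denotes the quotient of the free monoid $A^*$ by the congruence generated by $R$. *)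

(* Defs.v *)
From HB Require Import structures.
From mathcomp Require Import all_boot.
From mathcomp Require Import boolp.

Set Implicit Arguments.
Unset Strict Implicit.
Unset Printing Implicit Defensive.

(* [monoid_morphism] includes preservation of the identity. *)
Definition monoid_isomorphic (M N : monoidType) : Prop :=
  exists f : M -> N, monoid_morphism f /\ bijective f.

Section Presentation.
Local Open Scope quotient_scope.
Variables (A : choiceType) (R : seq A -> seq A -> Prop).

Inductive gen_cong : seq A -> seq A -> Prop :=
| GenCongBase u v : R u v -> gen_cong u v
| GenCongRefl u : gen_cong u u
| GenCongSym u v : gen_cong u v -> gen_cong v u
| GenCongTrans u v w : gen_cong u v -> gen_cong v w -> gen_cong u w
| GenCongCat u u' v v' :
    gen_cong u u' -> gen_cong v v' -> gen_cong (u ++ v) (u' ++ v').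

Definition gen_congb : rel (seq A) := fun u v => `[< gen_cong u v >].

Lemma gen_congb_refl : reflexive gen_congb.
Proof. by move=> u; apply/asboolP; exact: GenCongRefl. Qed.

Lemma gen_congb_sym : symmetric gen_congb.
Proof.
by move=> u v; apply/asboolP/asboolP; exact: GenCongSym.
Qed.

Lemma gen_congb_trans : transitive gen_congb.
Proof.
move=> v u w /asboolP uv /asboolP vw; apply/asboolP.
exact: GenCongTrans uv vw.
Qed.

Canonical gen_cong_equiv :=
  EquivRel gen_congb gen_congb_refl gen_congb_sym gen_congb_trans.

Definition presented : Type := {eq_quot gen_congb}.

HB.instance Definition _ := Choice.on presented.
HB.instance Definition _ := EqQuotient.on presented.

Definition presented_class (u : seq A) : presented := \pi_presented u.

Lemma presented_classP u v :
  presented_class u = presented_class v <-> gen_cong u v.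
Proof.
by split=> [/eqmodP/asboolP | uv] //; apply/eqmodP/asboolP.
Qed.

Lemma presented_class_repr (x : presented) : presented_class (repr x) = x.
Proof. exact: reprK. Qed.

Definition presented_one : presented := presented_class [::].

Definition presented_mul (x y : presented) : presented :=
  presented_class (repr x ++ repr y).

Lemma presented_mulE u v :
  presented_mul (presented_class u) (presented_class v)
  = presented_class (u ++ v).
Proof.
by apply/presented_classP/GenCongCat; apply/presented_classP;
  rewrite presented_class_repr.
Qed.

Lemma presented_mulA : associative presented_mul.
Proof.
move=> x y z.
rewrite -(presented_class_repr x) -(presented_class_repr y).
by rewrite -(presented_class_repr z) !presented_mulE catA.
Qed.

Lemma presented_mul1 : left_id presented_one presented_mul.
Proof.
by move=> x; rewrite -(presented_class_repr x) presented_mulE.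
Qed.

Lemma presented_mulr1 : right_id presented_one presented_mul.
Proof.
by move=> x; rewrite -(presented_class_repr x) presented_mulE cats0.
Qed.

HB.instance Definition _ :=
  isMonoid.Build presented presented_mulA presented_mul1 presented_mulr1.

End Presentation.

(* Throughout, [n] = {1, ..., n} is represented by the ordinals 'I_n
   = {0, ..., n-1}, with the same order. *)

Section OrderDecreasing.
Variable n : nat.

Definition order_decreasing (f : {ffun 'I_n -> 'I_n}) : bool :=
  [forall x, f x <= x].

Definition D : Type := {f : {ffun 'I_n -> 'I_n} | order_decreasing f}.

HB.instance Definition _ := [isSub of D for @proj1_sig _ _].
HB.instance Definition _ := [Finite of D by <:].

(* Maps act on the right, so f g is "first f, then g". *)
Definition comp_right (f g : {ffun 'I_n -> 'I_n}) : {ffun 'I_n -> 'I_n} :=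
  [ffun x => g (f x)].

Lemma order_decreasing_id : order_decreasing [ffun x => x].
Proof. by apply/forallP => x; rewrite ffunE. Qed.

Lemma order_decreasing_comp (f g : D) :
  order_decreasing (comp_right (val f) (val g)).
Proof.
apply/forallP => x; rewrite ffunE.
exact: leq_trans (forallP (valP g) _) (forallP (valP f) x).
Qed.

Definition D_one : D := Sub [ffun x => x] order_decreasing_id.

Definition D_mul (f g : D) : D :=
  Sub (comp_right (val f) (val g)) (order_decreasing_comp f g).

Lemma D_mulA : associative D_mul.
Proof. by move=> f g h; apply/val_inj/ffunP => x; rewrite !SubK !ffunE. Qed.

Lemma D_mul1 : left_id D_one D_mul.
Proof. by move=> f; apply/val_inj/ffunP => x; rewrite !SubK !ffunE. Qed.

Lemma D_mulr1 : right_id D_one D_mul.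
Proof. by move=> f; apply/val_inj/ffunP => x; rewrite !SubK !ffunE. Qed.

HB.instance Definition _ := isMonoid.Build D D_mulA D_mul1 D_mulr1.

End OrderDecreasing.

Section Relations.
Variable n : nat.

Definition gen : Type := {p : 'I_n * 'I_n | p.1 < p.2}.

HB.instance Definition _ := [isSub of gen for @proj1_sig _ _].
HB.instance Definition _ := [Finite of gen by <:].

Definition e (i j : 'I_n) (ij : i < j) : gen :=
  exist (fun p : 'I_n * 'I_n => p.1 < p.2) (i, j) ij.

Inductive M_rel : seq gen -> seq gen -> Prop :=
| MRelIdem (i j : 'I_n) (ij : i < j) :
    M_rel [:: e ij; e ij] [:: e ij]
| MRelComm (i j k l : 'I_n) (ij : i < j) (kl : k < l) :
    [set i; j] :&: [set k; l] = set0 ->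
    M_rel [:: e ij; e kl] [:: e kl; e ij]
| MRelLeft (i j k : 'I_n) (ij : i < j) (jk : j < k) :
    M_rel [:: e ij; e (ltn_trans ij jk)] [:: e jk; e ij]
| MRelRight (i j k : 'I_n) (ij : i < j) (jk : j < k) :
    M_rel [:: e (ltn_trans ij jk); e ij] [:: e jk; e ij]
| MRelAbsorb (i j k : 'I_n) (ik : i < k) (jk : j < k) :
    M_rel [:: e ik; e jk] [:: e ik].

Definition M : monoidType := presented M_rel.

End Relations.

(* Main.v *)
Require Import Defs.
From mathcomp Require Import all_boot.

Set Implicit Arguments.
Unset Strict Implicit.
Unset Printing Implicit Defensive.

(** Let [e_{i,j}] act as the map sending [j] to [i] and fixing every other
    point. A decreasing map [f] is then the product, in increasing order of [k],
    of the [e_{f(k),k}] with [f(k) < k]: once [k] has been sent to [f(k) < k], no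
    later factor moves it. These products are normal forms, because they are
    stable under right multiplication by [e_{i,j}]: the generator moves left past
    every factor [e_{a,k}] with [k > j], turning [a = j] into [a = i] and
    leaving other [a] unchanged; it is then absorbed by [e_{f(j),j}] if
    [f(j) < j], and otherwise takes the vacant place at [j]. *)

Section NormalForms.
Variable n : nat.

Local Notation "u ~~> v" := (gen_cong (@M_rel n) u v) (at level 70).

Definition redirect (g : gen n) (x : 'I_n) : 'I_n :=
  if x == (val g).2 then (val g).1 else x.

Lemma redirect_le g x : redirect g x <= x.
Proof.
by rewrite /redirect; case: eqP => // ->; case: g => [[i j] /= ij]; apply: ltnW.
Qed.

(** A left fold, since maps act on the right: the first letter acts first. *)
Definition act (w : seq (gen n)) (x : 'I_n) : 'I_n :=
  foldl (fun y g => redirect g y) x w.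

Lemma act_cat u v x : act (u ++ v) x = act v (act u x).
Proof. exact: foldl_cat. Qed.

Lemma act_le w x : act w x <= x.
Proof.
elim: w x => //= g w IHw x; exact: leq_trans (IHw _) (redirect_le g x).
Qed.

Lemma redirectE (i j : 'I_n) (ij : i < j) x :
  redirect (e ij) x = if x == j then i else x.
Proof. by []. Qed.

Lemma M_rel_act u v : M_rel u v -> act u =1 act v.
Proof.
have neq (i j : 'I_n) : i < j -> (i == j) = false.
  by move=> ij; apply/negbTE; rewrite -val_eqE /= ltn_eqF.
case=> [i j ij | i j k l ij kl disj | i j k ij jk | i j k ij jk | i j k ik jk] x
  /=; rewrite !redirectE.
- by case: (eqVneq x j) => [_ | /negbTE->] //; rewrite neq.
(* The two redirections commute because the moved points [j] and [l] differ and neither map moves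
   the target of the other ([j != k], [i != l]). *)
- have /andP[/negbTE jk /negbTE jl] : (j != k) && (j != l).
    rewrite -negb_or -in_set2; apply/negP => jkl.
    by have := in_set0 j; rewrite -disj !inE eqxx orbT -in_set2 jkl.
  have /negbTE il : i != l.
    apply/eqP => il; have := in_set0 i.
    by rewrite -disj !inE il eqxx !orbT.
  case: (eqVneq x j) => [-> | /negbTE xj]; first by rewrite il jl eqxx.
  by case: (eqVneq x l) => _; rewrite ?xj // eq_sym jk.
- have ik := ltn_trans ij jk.
  case: (eqVneq x j) => [-> | /negbTE xj].
    by rewrite (neq _ _ ik) (neq _ _ jk) eqxx.
  by case: (eqVneq x k) => _; rewrite ?eqxx ?xj.
- have ik := ltn_trans ij jk.
  case: (eqVneq x k) => [_ | _]; first by rewrite eqxx neq.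
  by [].
- by case: (eqVneq x k) => [_ | /negbTE->] //; rewrite neq.
Qed.

Lemma gen_cong_act u v : u ~~> v -> act u =1 act v.
Proof.
elim=> {u v} [u v /M_rel_act // | // | u v _ IH x | u v w _ IH1 _ IH2 x |
  u u' v v' _ IH1 _ IH2 x]; first by rewrite IH.
- by rewrite IH1.
- by rewrite !act_cat IH1 IH2.
Qed.

(** [insub] supplies the proof of [f k < k] that a letter must carry; at a fixed point it fails and
    the factor is the empty word. *)
Definition nf_step (f : 'I_n -> 'I_n) (k : 'I_n) : seq (gen n) :=
  seq_of_opt (insub (f k, k)).

(** Stated for any list of points, to allow induction and cutting the enumeration at [j]. *)
Definition nf_on f (s : seq 'I_n) : seq (gen n) := flatten (map (nf_step f) s).

Definition normal_form f := nf_on f (enum 'I_n).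

Lemma nf_step_lt (f : 'I_n -> 'I_n) k (fk : f k < k) : nf_step f k = [:: e fk].
Proof. by rewrite /nf_step insubT. Qed.

Lemma nf_step_nil (f : 'I_n -> 'I_n) k : f k = k -> nf_step f k = [::].
Proof. by move=> fk; rewrite /nf_step insubF //= fk ltnn. Qed.

Lemma eq_nf_step (f f' : 'I_n -> 'I_n) k : f k = f' k -> nf_step f k = nf_step f' k.
Proof. by rewrite /nf_step => ->. Qed.

Lemma pairwise_enum_ord :
  pairwise (fun x y : 'I_n => x < y) (enum 'I_n).
Proof.
by rewrite -(pairwise_map val ltn) val_enum_ord -sorted_pairwise ?iota_ltn_sorted //;
  exact: ltn_trans.
Qed.

Lemma act_nf_step (f : 'I_n -> 'I_n) k x :
  f k <= k -> act (nf_step f k) x = if x == k then f k else x.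
Proof.
rewrite leq_eqVlt => /orP[/eqP/val_inj fk | fk].
  by rewrite nf_step_nil //= fk; case: eqP.
by rewrite (nf_step_lt fk).
Qed.

Lemma act_nf_on (f : 'I_n -> 'I_n) s x :
    (forall k, f k <= k) -> pairwise (fun x y : 'I_n => x < y) s ->
  act (nf_on f s) x = if x \in s then f x else x.
Proof.
move=> f_le; elim: s x => //= k s IHs x /andP[/allP k_lt s_sorted].
rewrite /nf_on /= act_cat act_nf_step // -/(nf_on f s) IHs // inE.
(* For [x = k], a later factor could act only if [f k] occurred in [s], hence exceeded [k]. *)
case: eqP => [-> | _] //=; case: ifP => // /k_lt.
by rewrite ltnNge f_le.
Qed.

Lemma act_normal_form (f : 'I_n -> 'I_n) :
  (forall k, f k <= k) -> act (normal_form f) =1 f.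
Proof. by move=> f_le x; rewrite act_nf_on ?pairwise_enum_ord ?mem_enum. Qed.

Lemma nf_step_mul_lt (f : 'I_n -> 'I_n) (i j k : 'I_n) (ij : i < j) : j < k -> f k <= k ->
  nf_step f k ++ [:: e ij] ~~> e ij :: nf_step (redirect (e ij) \o f) k.
Proof.
move=> jk; rewrite leq_eqVlt => /orP[/eqP/val_inj fk | fk].
  have /negbTE kj : k != j by rewrite -val_eqE /= gtn_eqF.
  rewrite !nf_step_nil //= ?fk ?redirectE ?kj //; exact: GenCongRefl.
have ik := ltn_trans ij jk.
have [fkj | fkj] := eqVneq (f k) j.
  have f'k : (redirect (e ij) \o f) k = i by rewrite /= fkj redirectE eqxx.
  have f'k_lt : (redirect (e ij) \o f) k < k by rewrite f'k.
  rewrite (nf_step_lt fk) (nf_step_lt f'k_lt).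
  move: f'k_lt; rewrite f'k => {f'k}ik'; move: fk; rewrite fkj => jk'.
  (* Letters contain proofs of inequalities, which must be made syntactically those of the
     relation. *)
  rewrite (bool_irrelevance ik' (ltn_trans ij jk')).
  by apply/GenCongSym/GenCongBase/MRelLeft.
have f'k : (redirect (e ij) \o f) k = f k by rewrite /= redirectE (negbTE fkj).
rewrite (eq_nf_step f'k) (nf_step_lt fk) /=.
(* If [f k = i], both orders of the two letters equal $e_{j,k}e_{i,j}$; otherwise the index pairs
   are disjoint and the letters commute. *)
have [fki | fki] := eqVneq (f k) i.
  move: fk; rewrite fki => ik'; rewrite (bool_irrelevance ik' (ltn_trans ij jk)).
  apply: GenCongTrans (GenCongBase (MRelRight ij jk)) _.
  exact/GenCongSym/GenCongBase/MRelLeft.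
apply/GenCongBase/MRelComm/setP => x; rewrite !inE.
apply/negP => /andP[/orP[] /eqP-> /orP[] /eqP xE].
- by rewrite xE eqxx in fki.
- by rewrite xE eqxx in fkj.
- by have := ik; rewrite -xE ltnn.
- by have := jk; rewrite -xE ltnn.
Qed.

Lemma nf_on_mul_lt (f : 'I_n -> 'I_n) (i j : 'I_n) (ij : i < j) s :
    (forall k, f k <= k) -> {in s, forall k : 'I_n, j < k} ->
  nf_on f s ++ [:: e ij] ~~> e ij :: nf_on (redirect (e ij) \o f) s.
Proof.
move=> f_le; elim: s => [|k s IHs] s_gt; first exact: GenCongRefl.
rewrite /nf_on /= -!/(nf_on _ _) -catA.
have s_gt' : {in s, forall k : 'I_n, j < k}.
  by move=> l ls; apply: s_gt; rewrite inE ls orbT.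
(* The generator enters from the right, so it crosses the factors of [s] before the one at [k]. *)
apply: GenCongTrans (GenCongCat (GenCongRefl _ _) (IHs s_gt')) _.
rewrite -cat1s catA -cat_cons.
apply: GenCongCat (GenCongRefl _ _).
by apply: nf_step_mul_lt; rewrite ?s_gt ?mem_head.
Qed.

Lemma nf_step_mul_eq (f : 'I_n -> 'I_n) (i j : 'I_n) (ij : i < j) : f j <= j ->
  nf_step f j ++ [:: e ij] ~~> nf_step (redirect (e ij) \o f) j.
Proof.
rewrite leq_eqVlt => /orP[/eqP/val_inj fj | fj].
  have f'j : (redirect (e ij) \o f) j = i by rewrite /= fj redirectE eqxx.
  have f'j_lt : (redirect (e ij) \o f) j < j by rewrite f'j.
  rewrite nf_step_nil // (nf_step_lt f'j_lt).
  move: f'j_lt; rewrite f'j => ij'; rewrite (bool_irrelevance ij' ij).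
  exact: GenCongRefl.
have f'j : (redirect (e ij) \o f) j = f j.
  by rewrite /= redirectE -val_eqE /= ltn_eqF.
rewrite (eq_nf_step f'j) (nf_step_lt fj).
exact/GenCongBase/MRelAbsorb.
Qed.

Lemma normal_form_mul (f : 'I_n -> 'I_n) g : (forall k, f k <= k) ->
  normal_form f ++ [:: g] ~~> normal_form (redirect g \o f).
Proof.
case: g => [[i j] ij] f_le; rewrite -/(e ij) /normal_form.
have := mem_enum 'I_n j; have := pairwise_enum_ord.
move: (enum 'I_n) => s s_sorted js; case/splitPr: js s_sorted => s1 s2.
rewrite pairwise_cat /= => /and4P[/allrelP s1_lt _ /allP s2_gt _].
rewrite /nf_on !map_cat !flatten_cat /= -!/(nf_on _ _) -!catA.
(* Below [j] nothing changes: [f k <= k < j], so the value [f k] is never [j]. *)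
have -> : nf_on (redirect (e ij) \o f) s1 = nf_on f s1.
  congr flatten; apply/eq_in_map => k ks1; apply: eq_nf_step => /=.
  rewrite redirectE -val_eqE /= ltn_eqF //.
  by apply: leq_ltn_trans (f_le k) _; apply: s1_lt; rewrite ?mem_head.
apply: GenCongCat (GenCongRefl _ _) _.
apply: GenCongTrans (GenCongCat (GenCongRefl _ _) (nf_on_mul_lt _ f_le s2_gt)) _.
rewrite -cat1s catA.
exact: GenCongCat (nf_step_mul_eq _ (f_le j)) (GenCongRefl _ _).
Qed.

Lemma eq_normal_form f f' : f =1 f' -> normal_form f = normal_form f'.
Proof. by move=> ff'; congr flatten; apply: eq_map => k; apply: eq_nf_step. Qed.

(** Induction on the last letter, as normal forms are stable under right multiplication. *)
Lemma normal_formP w : w ~~> normal_form (act w).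
Proof.
elim/last_ind: w => [|w g IHw].
  suff -> : normal_form (act [::]) = [::] by exact: GenCongRefl.
  by rewrite /normal_form /nf_on; elim: (enum _) => //= k s ->; rewrite nf_step_nil.
rewrite -cats1 (_ : normal_form _ = normal_form (redirect g \o act w)).
  apply: GenCongTrans (GenCongCat IHw (GenCongRefl _ _)) _.
  by apply: normal_form_mul => k; apply: act_le.
by apply: eq_normal_form => x; rewrite act_cat.
Qed.

(** Words with the same action are congruent to one and the same normal form. *)
Lemma gen_congP u v : u ~~> v <-> act u =1 act v.
Proof.
split=> [|uv]; first exact: gen_cong_act.
apply: GenCongTrans (normal_formP u) _; rewrite (eq_normal_form uv).
exact/GenCongSym/normal_formP.
Qed.

Lemma order_decreasing_act w : order_decreasing [ffun x => act w x].
Proof. by apply/forallP => x; rewrite ffunE act_le. Qed.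

Definition eval_word w : D n := Sub [ffun x => act w x] (order_decreasing_act w).

Lemma val_eval_word w x : val (eval_word w) x = act w x.
Proof. by rewrite SubK ffunE. Qed.

Lemma eval_word_eq u v : eval_word u = eval_word v <-> u ~~> v.
Proof.
rewrite gen_congP; split=> [uv x | uv]; first by rewrite -!val_eval_word uv.
by apply/val_inj/ffunP => x; rewrite !val_eval_word uv.
Qed.

Lemma eval_word_cat u v : eval_word (u ++ v) = (eval_word u * eval_word v)%g.
Proof.
by apply/val_inj/ffunP => x; rewrite [RHS]ffunE !val_eval_word act_cat.
Qed.

Lemma eval_normal_form (f : D n) : eval_word (normal_form (val f)) = f.
Proof.
apply/val_inj/ffunP => x; rewrite val_eval_word act_normal_form //.
exact/forallP/(valP f).
Qed.

(** Uses the chosen representative; [eval_class] shows independence of that choice. *)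
Definition eval (x : M n) : D n := eval_word (repr (x : presented (@M_rel n))).

Lemma eval_class w : eval (presented_class (@M_rel n) w) = eval_word w.
Proof. exact/eval_word_eq/presented_classP/presented_class_repr. Qed.

End NormalForms.

Theorem mainTheorem1 (n : nat) (hn : 1 <= n) : monoid_isomorphic (M n) (D n).
Proof.
exists (@eval n); split.
  split=> [|x y].
    rewrite [LHS]eval_class; apply/val_inj/ffunP => x.
    by rewrite [RHS]ffunE val_eval_word.
  (* The product in [M n] unfolds to the class of the concatenated representatives. *)
  by rewrite [LHS]eval_class eval_word_cat.
exists (fun f : D n => presented_class (@M_rel n) (normal_form (val f))) => [x | f].
  rewrite -[RHS]presented_class_repr; apply/presented_classP/eval_word_eq.
  exact: eval_normal_form.
by rewrite eval_class eval_normal_form.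
Qed.
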